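(* Let $n$ be a positive integer and $\mathbf b=(b_1,\dots,b_n)\in\mathbb Z_{>0}^n$, not with $n=1=b_1$. Let $\mathbf v$ and $\mathbf w$ be vertices of $\mathfrak X_n(\mathbf b)$. Fix $\pi\in\mathfrak S_n$ and $k\in\mathbb Z$ with $0\le k\le n$ such that $\mathbf v=\pi(\mathbf v_k)$. (a) If $b_1\ge 2$, or if $b_1=1$ and $k\ge 2$, then $\mathbf v$ and $\mathbf w$ share an edge of $\mathfrak X_n(\mathbf b)$ if and only if either (1) $\mathbf w=(\pi\circ(j,k))(\mathbf v_{k-1})$ for some $1\le j\le k$, in which case $\mathbf w-\mathbf v=(S_k-1)\,\mathbf e_{\pi(j)}$; or (2) $\mathbf w=(\pi\circ(j-1,j))(\mathbf v_k)$ for some $k+2\le j\le n$, in which case $\mathbf w-\mathbf v=b_j(\mathbf e_{\pi(j-1)}-\mathbf e_{\pi(j)})$; or (3) $k\le n-1$ and $\mathbf w=\pi(\mathbf v_{k+1})$, in which case $\mathbf w-\mathbf v=-(S_{k+1}-1)\,\mathbf e_{\pi(k+1)}$. (b) If $b_1=1$ and $k\in\{0,1\}$ (so that $\mathbf v_k=\mathbf v_0=\mathbf v_1$), then $\mathbf v$ and $\mathbf w$ share an edge of $\mathfrak X_n(\mathbf b)$ if and only if either (1) $\mathbf w=(\pi\circ(j-1,j))(\mathbf v_1)$ for some $2\le j\le n$, in which case $\mathbf w-\mathbf v=b_j(\mathbf e_{\pi(j-1)}-\mathbf e_{\pi(j)})$; or (2) $\mathbf w=\pi(\mathbf v_2)$,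 in which case $\mathbf w-\mathbf v=-b_2\,\mathbf e_{\pi(2)}$.
   Context: A $\mathbf b$-parking function is a list $(\beta_1,\dots,\beta_n)$ of positive integers whose nondecreasing rearrangement $\beta'_1\le\cdots\le\beta'_n$ satisfies $\beta'_i\le b_1+\cdots+b_i$ for all $i$. The $\mathbf b$-parking-function polytope $\mathfrak X_n(\mathbf b)\subset\mathbb R^n$ is the convex hull of all $\mathbf b$-parking functions. Write $S_i=\sum_{j=1}^i b_j$ for $1\le i\le n$ and $\mathbf v_k=(1,\dots,1,S_{k+1},\dots,S_n)\in\mathbb R^n$ for $0\le k\le n$ (the first $k$ entries are $1$); every vertex of $\mathfrak X_n(\mathbf b)$ has the form $\pi(\mathbf v_k)$. The symmetric group $\mathfrak S_n$ acts linearly on $\mathbb R^n$ by $\pi\left(\sum_i a_i\mathbf e_i\right)=\sum_i a_i\mathbf e_{\pi(i)}$, where $\mathbf e_1,\dots,\mathbf e_n$ is the standard basis. $(i,j)$ denotes the transposition of $i$ and $j$ in $\mathfrak S_n$, and is the identity if $i=j$. Two vertices share an edge if they are the two endpoints of a $1$-dimensional face. *)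

(* Defs.v *)
From mathcomp Require Import all_boot all_order all_fingroup all_algebra.
From mathcomp Require Import mathcomp_extra boolp classical_sets reals convex.

Set Implicit Arguments.
Unset Strict Implicit.
Unset Printing Implicit Defensive.

Import Order.TTheory GRing.Theory Num.Theory.

Local Open Scope classical_set_scope.
Local Open Scope ring_scope.

Section Polytopes.
Context {R : realType} {n : nat}.
Implicit Types (A P F : set 'rV[R]_n) (v w : 'rV[R]_n).

Definition conv_hull A : set 'rV[R]_n :=
  smallest (@convex_set R 'rV[R]_n : set (set 'rV[R]_n)) A.

(* The subset of P on which a valid inequality a . x <= c is tight; a = 0 is
   allowed, so P itself (c = 0) and the empty set (c = 1) are faces. *)
Definition face P F : Prop :=
  exists (a : 'rV[R]_n) (c : R),
    (forall x, P x -> \sum_i a 0 i * x 0 i <= c)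
    /\ F = [set x | P x /\ \sum_i a 0 i * x 0 i = c].

(* A nonempty set A has dimension d when its affine hull is x0 + rowspace(M),
   the d rows of M being linearly independent.  The empty set has none. *)
Definition has_dim A (d : nat) : Prop :=
  exists (x0 : 'rV[R]_n) (M : 'M[R]_(d, n)),
    [/\ row_free M, A x0, (forall i, A (x0 + row i M))
      & forall x, A x -> (x - x0 <= M)%MS].

Definition vertex P v : Prop := face P [set v] /\ has_dim [set v] 0.

Definition share_edge P v w : Prop :=
  exists F, [/\ face P F, has_dim F 1 & F = conv_hull [set v; w]].

End Polytopes.

(* S_i = b_1 + ... + b_i; the index type 'I_n is 0-based, so b_1, ..., b_i are
   the values of b at the j : 'I_n with j < i. *)
Definition psum n (b : 'I_n -> nat) (i : nat) : nat :=
  (\sum_(j < n | (j < i)%N) b j)%N.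

Definition parking n (b : 'I_n -> nat) (beta : n.-tuple nat) : Prop :=
  (forall i, 0 < tnth beta i)%N
  /\ forall i : 'I_n, (nth 0 (sort leq beta) i <= psum b i.+1)%N.

Definition pf_polytope {R : realType} n (b : 'I_n -> nat) : set 'rV[R]_n :=
  conv_hull [set x | exists beta : n.-tuple nat,
                       parking b beta /\ x = \row_i (tnth beta i)%:R].

(* v_k = (1, ..., 1, S_(k+1), ..., S_n), with k leading ones. *)
Definition vk {R : realType} n (b : 'I_n -> nat) (k : nat) : 'rV[R]_n :=
  \row_(i < n) if (i < k)%N then 1 else (psum b i.+1)%:R.

Definition evec {R : realType} n (i : 'I_n) : 'rV[R]_n := delta_mx 0 i.

Definition perm_act {R : realType} n (s : 'S_n) (x : 'rV[R]_n) : 'rV[R]_n :=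
  \sum_i x 0 i *: evec (s i).

(* Composition of functions: permutation products are read left to right. *)
Definition perm_comp n (s t : 'S_n) : 'S_n := (t * s)%g.

(* The element of {1, ..., m+1} written j, as an element of the 0-based
   'I_m.+1; only meaningful for 1 <= j <= m+1. *)
Definition idx {m : nat} (j : nat) : 'I_m.+1 := inord j.-1.

(* Main.v *)
Require Import Defs.
From mathcomp Require Import all_boot all_order all_fingroup all_algebra.
From mathcomp Require Import mathcomp_extra boolp classical_sets reals convex.
From mathcomp Require Import interval_inference zify lra.

Import Order.TTheory GRing.Theory Num.Theory.
Local Open Scope ring_scope.

(* Besides x_i >= 1, the polytope satisfies, for every permutation s and every
   j, the inequality [sum_(l >= j) x_(s l) <= sum_(l >= j) S_l].  At the vertex
   v = pi (v_k), exactly n of these inequalities (x_(pi i) >= 1 for i <= k, and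
   the tail inequalities of pi for j > k) suffice to cut out a simplicial cone
   containing the polytope.  The generators of that cone are the n vectors w - v
   listed in the theorem; each v + (w - v) lies in the polytope, and one of its
   inequalities is violated beyond w.  Hence v is a simple vertex, whose edges
   are the segments [v, w].  When b_1 = 1 and k <= 1, more than n inequalities
   are tight at v: the cone is cut out by x_(pi 1) >= 1 and the tail
   inequalities for j <> 2, the one for j = 2 being redundant. *)

(** * Convex hulls, segments, and the edges at a simple vertex *)

Section Convexity.
Context {R : realType} {n : nat}.
Implicit Types (A P : set 'rV[R]_n) (a v w x y : 'rV[R]_n).
Local Open Scope classical_set_scope.

Lemma convex_setP A :
  convex_set A <->
  (forall x y (t : R), 0 <= t -> t <= 1 -> A x -> A y ->
     A (t *: x + (1 - t) *: y)).
Proof.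
split=> [cA x y t t0 t1 Ax Ay|cA x y t].
  by have := cA x y (Itv01 t0 t1); rewrite !inE; apply.
by rewrite !inE => Ax Ay; apply: cA.
Qed.

Lemma convex_conv_hull A : convex_set (conv_hull A).
Proof.
apply/convex_setP => x y t t0 t1 hx hy B [cB AB].
by have /convex_setP := cB; apply => //; [apply: hx | apply: hy].
Qed.

Lemma sub_conv_hull A : A `<=` conv_hull A.
Proof. by move=> x Ax B [_ AB]; apply: AB. Qed.

Lemma conv_hull_min A P : convex_set P -> A `<=` P -> conv_hull A `<=` P.
Proof. by move=> cP AP x hx; apply: (hx P). Qed.

Lemma scalar0 (f : 'rV[R]_n -> R) : scalar f -> f 0 = 0.
Proof.
by move=> fL; have := fL (-1) 0 0; rewrite scaler0 addr0 mulN1r addNr.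
Qed.

Lemma conv_hull_ge (f : 'rV[R]_n -> R) A c : scalar f ->
  (forall x, A x -> c <= f x) -> forall x, conv_hull A x -> c <= f x.
Proof.
move=> fL Ac; apply: conv_hull_min Ac.
apply/convex_setP => x y t t0 t1 /= hx hy.
have f0 := scalar0 _ fL.
have fZ (r : R) z : f (r *: z) = r * f z by rewrite -[r *: z]addr0 fL f0 addr0.
by rewrite fL fZ; nra.
Qed.

Lemma conv_hull2P v w x :
  conv_hull [set v; w] x <->
  exists t : R, [/\ 0 <= t, t <= 1 & x = v + t *: (w - v)].
Proof.
split.
  move: x; apply: conv_hull_min => [|x []->]; last 2 first.
  - by exists 0; rewrite scale0r addr0.
  - by exists 1; rewrite scale1r addrC subrK.
  apply/convex_setP => _ _ t t0 t1 [r [r0 r1 ->]] [s [s0 s1 ->]].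
  exists (t * r + (1 - t) * s); split; [nra|nra|].
  by apply/rowP => i; rewrite !mxE; lra.
move=> [t [t0 t1 ->]].
have /convex_setP cvx := @convex_conv_hull [set v; w].
have -> : v + t *: (w - v) = t *: w + (1 - t) *: v.
  by apply/rowP => i; rewrite !mxE; lra.
by apply: cvx => //; apply: sub_conv_hull; [right | left].
Qed.

(* [v] is a simple vertex: the cone generated by [P - v] is spanned by the basis
   [row i D], and the columns of [A] are the dual basis. *)
Lemma share_edge_simple P v w (D A : 'M[R]_n) :
  convex_set P -> P v -> D *m A = 1%:M ->
  (forall i, P (v + row i D)) ->
  (forall i x, P x -> 0 <= ((x - v) *m A) 0 i) ->
  (forall i (s : R), P (v + s *: row i D) -> s <= 1) ->
  share_edge P v w <-> exists i, w = v + row i D.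
Proof.
move=> cP Pv DA PD PA Pmax.
have AD := mulmx1C DA.
have rowDA i j : (row i D *m A) 0 j = (i == j)%:R.
  by rewrite -row_mul DA !mxE.
have expand (y : 'rV[R]_n) : y = \sum_i (y *m A) 0 i *: row i D.
  by rewrite -mulmx_sum_row -mulmxA AD mulmx1.
have rowD0 i : row i D != 0.
  apply/eqP => D0; have := rowDA i i.
  by rewrite D0 mul0mx mxE eqxx => /esym/eqP; rewrite oner_eq0.
pose dot a x := \sum_i a 0 i * x 0 i.
have dotE a x : dot a x = (x *m a^T) 0 0.
  by rewrite !mxE; apply: eq_bigr => i _; rewrite !mxE mulrC.
have dotD a x y : dot a (x + y) = dot a x + dot a y.
  by rewrite !dotE mulmxDl [LHS]mxE.
have dotZ a t x : dot a (t *: x) = t * dot a x.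
  by rewrite !dotE -scalemxAl [LHS]mxE.
split.
  move=> [F [[a [c [ac FE]]] [x0 [M [Mfree Fx0 FM Fspan]]] FC]].
  (* For [v = w] the segment [F] is the single point [v], so the one row of [M] vanishes,
     contradicting its linear independence. *)
  have vw : v != w.
    apply/eqP => vw; have Fv x : F x -> x = v.
      by rewrite FC => /conv_hull2P[t [_ _ ->]]; rewrite vw subrr scaler0 addr0.
    have := Fv _ (FM 0); rewrite (Fv _ Fx0) => /(congr1 (fun y => y - v)).
    rewrite addrC addKr subrr => M0.
    by move: Mfree; rewrite -row_leq_rank (_ : M = 0) ?mxrank0 //;
       apply/row_matrixP => i; rewrite ord1 M0 row0.
  have [Pv' av] : P v /\ dot a v = c.
    have : F v by rewrite FC; apply: sub_conv_hull; left.
    by rewrite FE.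
  have [Pw aw] : P w /\ dot a w = c.
    have : F w by rewrite FC; apply: sub_conv_hull; right.
    by rewrite FE.
  have ad i : dot a (row i D) <= 0.
    have := ac _ (PD i); rewrite -[X in X <= c]/(dot a _) -av dotD.
    by rewrite gerDl.
  (* Expanding [a . (w - v) = 0] in the basis [row i D] gives a sum of nonnegative terms, so each
     term vanishes: [a] is zero on every direction that [w - v] involves. *)
  have sum0 : \sum_i ((w - v) *m A) 0 i * - dot a (row i D) = 0.
    under eq_bigr => i _ do rewrite mulrN.
    apply/eqP; rewrite sumrN oppr_eq0; apply/eqP.
    transitivity (dot a (w - v)).
      rewrite [in RHS](expand (w - v)) dotE mulmx_suml summxE.
      by apply: eq_bigr => i _; rewrite -scalemxAl [RHS]mxE dotE.
    by rewrite dotD -scaleN1r dotZ aw av mulN1r subrr.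
  have tight i : ((w - v) *m A) 0 i != 0 -> dot a (row i D) = 0.
    have ge0 j : true -> 0 <= ((w - v) *m A) 0 j * - dot a (row j D).
      by move=> _; rewrite mulr_ge0 ?PA // oppr_ge0.
    have /eqP := psumr_eq0P ge0 sum0 (i := i) isT.
    by rewrite mulf_eq0 oppr_eq0 => /orP[->//|/eqP].
  have [i ci] : exists i, ((w - v) *m A) 0 i != 0.
    apply: contrapT => no; move/eqP: vw; apply; apply/esym/eqP.
    rewrite -subr_eq0 (expand (w - v)) big1 // => i _.
    by have [->|ci] := eqVneq (((w - v) *m A) 0 i) 0;
       [rewrite scale0r | case: no; exists i].
  (* The point [v + row i D] lies on the segment, so [w - v] is [t^-1] times this direction with
     [t <= 1]; [Pmax] gives [t^-1 <= 1], hence [t = 1]. *)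
  have : F (v + row i D).
    rewrite FE; split; first exact: PD.
    by rewrite -[LHS]/(dot a _) dotD tight // addr0.
  rewrite FC => /conv_hull2P[t [t0 t1 /addrI dt]].
  have tn0 : t != 0.
    by apply: contraNneq (rowD0 i) => t0'; rewrite dt t0' scale0r.
  have wE : w = v + t^-1 *: row i D.
    by rewrite dt scalerA mulVf // scale1r addrC subrK.
  have tp : 0 < t by rewrite lt_def tn0.
  have := Pmax i t^-1; rewrite -wE => /(_ Pw); rewrite invf_le1 // => t1'.
  by exists i; rewrite wE (_ : t = 1) ?invr1 ?scale1r //; apply/le_anti/andP.
move=> [i ->].
(* The functional is minus the sum of the dual coordinates other than the [i]-th: on [P - v] it is
   at most [0], with equality only along [row i D]. *)
pose u : 'cV[R]_n := \col_j (j != i)%:R.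
pose a := - (A *m u)^T.
have dota x : dot a x = - \sum_(j | j != i) (x *m A) 0 j.
  rewrite dotE /a linearN /= trmxK mulmxN mxE mulmxA mxE [in RHS]big_mkcond.
  congr (- _); apply: eq_bigr => j _; rewrite [u _ _]mxE.
  by case: (j != i); rewrite ?mulr1 ?mulr0.
have dotB x : dot a x - dot a v = - \sum_(j | j != i) ((x - v) *m A) 0 j.
  by rewrite -dota dotD -scaleN1r dotZ mulN1r.
have dotd : dot a (v + row i D) = dot a v.
  apply/eqP; rewrite -subr_eq0 dotB addrC addKr oppr_eq0; apply/eqP.
  by apply: big1 => j /negPf ji; rewrite rowDA eq_sym ji.
have line x : P x -> dot a x = dot a v ->
    exists s : R, [/\ 0 <= s, s <= 1 & x = v + s *: row i D].
  move=> Px /eqP; rewrite -subr_eq0 dotB oppr_eq0 => /eqP s0.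
  have x0 j : j != i -> ((x - v) *m A) 0 j = 0.
    by move: j; apply: psumr_eq0P s0 => j _; apply: PA.
  have xE : x = v + ((x - v) *m A) 0 i *: row i D.
    rewrite -[LHS](subrK v) addrC; congr (_ + _).
    rewrite {1}(expand (x - v)) (bigD1 i) //= big1 ?addr0 // => j ji.
    by rewrite x0 // scale0r.
  exists (((x - v) *m A) 0 i); split => //; first exact: PA.
  by apply: (Pmax i); rewrite -xE.
exists [set x | P x /\ dot a x = dot a v]; split.
- exists a, (dot a v); split => // x Px.
  rewrite -[X in X <= _]/(dot a x) -subr_le0 dotB oppr_le0.
  by apply: sumr_ge0 => j _; exact: PA.
- exists v, (row i D); split.
  + by rewrite -row_leq_rank rank_rV rowD0.
  + by [].
  + by move=> j; rewrite ord1 row_id.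
  + move=> x [Px ax]; have [s [_ _ ->]] := line x Px ax.
    by rewrite addrC addKr scalemx_sub.
apply/seteqP; split => x.
  move=> [Px ax]; apply/conv_hull2P.
  have [s [s0 s1 ->]] := line x Px ax.
  by exists s; split => //; rewrite [v + row i D]addrC addrK.
move: x; apply: conv_hull_min => [|x [->|->]] /=; last 2 first.
- by [].
- by split; [exact: PD|].
apply/convex_setP => x y t t0 t1 /= [Px ax] [Py ay]; split.
  by move/convex_setP: cP; apply.
by rewrite dotD !dotZ ax ay; lra.
Qed.

Lemma scalar_sum (f : 'rV[R]_n -> R) x :
  scalar f -> f x = \sum_p x 0 p * f (delta_mx 0 p).
Proof.
move=> fL.
have f0 := scalar0 _ fL.
have fD : {morph f : y z / y + z} by move=> y z;
  rewrite -[y]scale1r fL mul1r scale1r.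
rewrite [in LHS](row_sum_delta x) (big_morph f fD f0).
by apply: eq_bigr => p _; rewrite -[_ *: _]addr0 fL f0 addr0.
Qed.

(** Form in which the criterion is applied: the dual basis is given by linear functionals [f], whose
    values on the standard basis are the columns of the matrix [A]. *)
Lemma share_edge_dual_basis P v w (d : 'I_n -> 'rV[R]_n)
    (f : 'I_n -> 'rV[R]_n -> R) :
  convex_set P -> P v -> (forall i, scalar (f i)) ->
  (forall i j, f j (d i) = (i == j)%:R) ->
  (forall i, P (v + d i)) ->
  (forall i x, P x -> 0 <= f i (x - v)) ->
  (forall i (s : R), P (v + s *: d i) -> s <= 1) ->
  share_edge P v w <-> exists i, w = v + d i.
Proof.
move=> cP Pv fL fd Pd Pf Pmax.
pose D := \matrix_i d i; pose A := \matrix_(p, j) f j (delta_mx 0 p).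
have AE y j : (y *m A) 0 j = f j y.
  by rewrite mxE (scalar_sum _ y (fL j)); apply: eq_bigr => p _; rewrite mxE.
have DE i : row i D = d i by rewrite rowK.
have -> : (exists i, w = v + d i) = (exists i, w = v + row i D).
  by congr ex; apply/funext => i; rewrite DE.
apply: (@share_edge_simple P v w D A) => // [|i|i x Px|i s].
- by apply/row_matrixP => i; apply/rowP => j; rewrite row_mul AE DE fd !mxE.
- by rewrite DE.
- by rewrite AE; exact: Pf.
- by rewrite DE; exact: Pmax.
Qed.

End Convexity.

(** * Partial sums and parking functions *)

Section Psum.
Context {n : nat} (b : 'I_n -> nat).
Local Open Scope nat_scope.

Lemma psumS (i : 'I_n) : psum b i.+1 = psum b i + b i.
Proof.
rewrite /psum (bigD1 i) //= addnC; congr (_ + _).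
by apply: eq_bigl => j; rewrite ltnS andbC -ltn_neqAle.
Qed.

Lemma leq_psum i j : i <= j -> psum b i <= psum b j.
Proof.
move=> ij; rewrite /psum [leqLHS]big_mkcond [leqRHS]big_mkcond.
apply: leq_sum => l _; case: ifP => // li.
by rewrite (leq_trans li ij).
Qed.

(* Exchanging the sums over [l] and over the summands [b t] of [psum], this
   compares the numbers of [l] with [j <= l] and [t <= s l], resp. [t <= l]. *)
Lemma sum_psum_perm (s : 'S_n) j :
  \sum_(l < n | j <= l) psum b (s l).+1 <= \sum_(l < n | j <= l) psum b l.+1.
Proof.
have E (r : 'S_n) : \sum_(l < n | j <= l) psum b (r l).+1 =
    \sum_(t < n) b t * \sum_(l < n | j <= l) (t <= r l).
  under [RHS]eq_bigr => t _ do rewrite big_distrr.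
  rewrite exchange_big; apply: eq_bigr => l _ /=.
  rewrite /psum big_mkcond; apply: eq_bigr => t _.
  by rewrite ltnS; case: (t <= r l); rewrite ?muln1 ?muln0.
have := E 1%g; under eq_bigr => l _ do rewrite perm1.
move=> ->; rewrite E; apply: leq_sum => t _.
rewrite leq_mul2l; apply/orP; right.
(* If [t <= j], every indicator on the right is [1]. Otherwise [t <= l] forces [j <= l], so the
   right side counts all [l] with [t <= l], and these are as many as the [l] with [t <= s l]. *)
have [tj|jt] := leqP t j.
  apply: leq_sum => l jl; rewrite perm1 (leq_trans tj jl); exact: leq_b1.
apply: (@leq_trans (\sum_(l < n) (t <= s l))).
  by rewrite [leqLHS]big_mkcond; apply: leq_sum => l _; case: ifP.
have -> : \sum_(l < n) (t <= s l) = \sum_(l < n) (t <= l).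
  by rewrite [RHS](reindex_perm s).
rewrite [leqRHS]big_mkcond /=.
apply: leq_sum => l _; rewrite perm1; case: (leqP t l) => // tl.
by rewrite (leq_trans (ltnW jt) tl).
Qed.

(** The permutation [s] sends each rank to a position holding the entry of that rank in sorted
    order, so that the parking condition can be used without [sort]. *)
Lemma parking_perm (beta : n.-tuple nat) : parking b beta ->
  exists s : 'S_n, forall l, tnth beta (s l) <= psum b l.+1.
Proof.
move=> [_ hbeta].
have /tuple_permP[s sE] : perm_eq (sort leq beta) beta by rewrite perm_sort.
exists s => l; apply: leq_trans (hbeta l); rewrite sE -(tnth_nth 0 _ l).
by rewrite tnth_mktuple.
Qed.

(** The sequence [1, ..., 1, S_(k+1), ..., S_n] is already nondecreasing, hence is the sorted form
    of [beta]; its leading ones satisfy the bound because every [S_l] is positive. *)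
Lemma parking_vk (hb : forall i, 0 < b i) (beta : n.-tuple nat) (s : 'S_n) k :
  (forall l, tnth beta (s l) = if l < k then 1 else psum b l.+1) ->
  parking b beta.
Proof.
move=> betaE.
have S_gt0 (l : 'I_n) : 0 < psum b l.+1 by rewrite psumS addn_gt0 hb orbT.
pose u := [tuple tnth beta (s l) | l < n].
have sortE : sort leq beta = u.
  have -> : sort leq beta = sort leq u.
    apply/(perm_sortP leq_total leq_trans anti_leq).
    by rewrite perm_sym; apply/tuple_permP; exists s.
  apply: (sorted_sort leq_trans); apply/(sortedP 0) => i.
  rewrite size_tuple => iS.
  rewrite -[i.+1]/(nat_of_ord (Ordinal iS)).
  rewrite -[i in nth _ _ i]/(nat_of_ord (Ordinal (ltnW iS))).
  rewrite -!tnth_nth !tnth_mktuple !betaE /=.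
  case: ifP => ik; first by case: ifP => // _; exact: (S_gt0 (Ordinal iS)).
  rewrite ifF; first exact: leq_psum.
  by apply: contraFF ik => /ltnW.
split=> [i|i].
  by rewrite -(permKV s i) betaE; case: ifP.
by rewrite sortE -tnth_nth tnth_mktuple betaE; case: ifP.
Qed.

End Psum.

(** * Points of the polytope and its valid inequalities *)

Section Polytope.
Context {R : realType} {n : nat} {b : 'I_n -> nat}.
Local Notation P := (pf_polytope b : classical_sets.set 'rV[R]_n).

Lemma perm_actE (s : 'S_n) (x : 'rV[R]_n) i : perm_act s x 0 (s i) = x 0 i.
Proof.
rewrite summxE (bigD1 i) //= big1 => [|j ji]; rewrite /evec !mxE ?eqxx /=.
  by rewrite mulr1 addr0.
by rewrite (inj_eq perm_inj) eq_sym (negPf ji) mulr0.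
Qed.

Lemma pf_polytope_vk (hb : forall i, (0 < b i)%N) (s : 'S_n) k :
  P (perm_act s (vk b k)).
Proof.
pose r := (s^-1)%g.
pose beta := [tuple if (r i < k)%N then 1%N else psum b (r i).+1 | i < n].
apply: sub_conv_hull; exists beta; split.
  by apply: (@parking_vk _ _ hb beta s k) => l; rewrite tnth_mktuple permK.
apply/rowP => i; rewrite -(permKV s i) perm_actE !mxE tnth_mktuple permK.
by case: ifP.
Qed.

Lemma pf_polytope_ge1 x i : P x -> 1 <= x 0 i.
Proof.
move: x; apply: (@conv_hull_ge _ _ (fun x => x 0 i)).
  by move=> t x y; rewrite !mxE.
by move=> _ [beta [[beta0 _] ->]]; rewrite mxE ler1n.
Qed.

(** It suffices to check parking functions. There [parking_perm] bounds the entries by partial sums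
    permuted by [s * r^-1], and [sum_psum_perm] applies. Signs are reversed because [conv_hull_ge]
    treats lower bounds. *)
Lemma pf_polytope_tail x (s : 'S_n) j : P x ->
  \sum_(l < n | (j <= l)%N) x 0 (s l) <=
  \sum_(l < n | (j <= l)%N) (psum b l.+1)%:R.
Proof.
rewrite -lerN2; move: x.
apply: (@conv_hull_ge _ _ (fun x => - \sum_(l < n | (j <= l)%N) x 0 (s l))).
  move=> t x y; rewrite mulrN -opprD mulr_sumr -big_split; congr (- _).
  by apply: eq_bigr => l _; rewrite !mxE.
move=> _ [beta [/parking_perm[r hr] ->]]; rewrite lerN2.
under eq_bigr => l _ do rewrite mxE.
rewrite -!natr_sum ler_nat; apply: leq_trans (sum_psum_perm _ (s * r^-1)%g _).
by apply: leq_sum => l _; rewrite -{1}(permKV r (s l)) permM.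
Qed.

End Polytope.

Lemma idxS m (i : 'I_m.+1) : idx i.+1 = i.
Proof. exact: inord_val. Qed.

Lemma idx_val m (i : nat) : (i <= m.+1)%N -> (idx i : 'I_m.+1) = i.-1 :> nat.
Proof. by move=> im; rewrite inordK //; lia. Qed.

(** * Tail sums as linear functionals *)

Section Tail.
Context {R : realType} {n : nat}.
Implicit Types (s : 'S_n) (x : 'rV[R]_n).

Definition tail s j x : R := \sum_(l < n | (j <= l)%N) x 0 (s l).

Lemma tail_scalar s j : scalar (tail s j).
Proof.
move=> t x y; rewrite /tail mulr_sumr -big_split.
by apply: eq_bigr => l _; rewrite !mxE.
Qed.

Lemma tailD s j x y : tail s j (x + y) = tail s j x + tail s j y.
Proof. by rewrite -[x]scale1r tail_scalar mul1r scale1r. Qed.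

Lemma tailZ s j t x : tail s j (t *: x) = t * tail s j x.
Proof.
by rewrite -[_ *: _]addr0 tail_scalar (scalar0 _ (tail_scalar s j)) addr0.
Qed.

Lemma tailB s j x y : tail s j (x - y) = tail s j x - tail s j y.
Proof. by rewrite tailD -scaleN1r tailZ mulN1r. Qed.

Lemma evecE s i l : evec (s i) 0 (s l) = (i == l)%:R :> R.
Proof. by rewrite mxE eqxx (inj_eq perm_inj) eq_sym. Qed.

Lemma tail_evec s j i : tail s j (evec (s i)) = (j <= i)%N%:R.
Proof.
rewrite /tail; under eq_bigr => l _ do rewrite evecE.
case: (leqP j i) => ji.
  rewrite (bigD1 i) //= eqxx big1 ?addr0 // => l /andP[_ li].
  by rewrite eq_sym (negPf li).
rewrite big1 // => l jl; case: eqP => // il; move: jl; rewrite -il; lia.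
Qed.

Lemma perm_act_comp s (t : 'S_n) x l : t (t l) = l ->
  perm_act (perm_comp s t) x 0 (s l) = x 0 (t l).
Proof. by move=> tl; rewrite -[in LHS]tl -[s _]permM perm_actE. Qed.

End Tail.

(** * The vectors from a vertex to its neighbours, and how far the polytope extends along them *)

Section Neighbours.
Context {R : realType} {m : nat} {b : 'I_m.+1 -> nat}.
Implicit Types (pi s : 'S_m.+1) (v w : 'rV[R]_m.+1) (i : 'I_m.+1).
Hypothesis hb : forall i, (0 < b i)%N.
Local Notation P := (pf_polytope b : classical_sets.set 'rV[R]_m.+1).

Lemma perm_vkE pi k i :
  perm_act pi (vk b k) 0 (pi i) =
  if (i < k)%N then 1 else (psum b i.+1)%:R :> R.
Proof. by rewrite perm_actE mxE. Qed.

Lemma tail_vk pi k j : (k <= j)%N ->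
  tail pi j (perm_act pi (vk b k)) =
  \sum_(l < m.+1 | (j <= l)%N) (psum b l.+1)%:R :> R.
Proof.
move=> kj; apply: eq_bigr => l jl; rewrite perm_vkE ifF //.
by apply/negbTE; rewrite -leqNgt (leq_trans kj jl).
Qed.

(** [v_(k-1)] differs from [v_k] only by the entry [S_k] at position [k], and the transposition
    carries this entry to the position of [i]. *)
Lemma raise_one pi k i : (i < k <= m.+1)%N ->
  perm_act (perm_comp pi (tperm i (idx k))) (vk b k.-1) - perm_act pi (vk b k)
  = ((psum b k)%:R - 1) *: evec (pi i) :> 'rV[R]_m.+1.
Proof.
move=> /andP[ik km]; have k0 : (0 < k)%N := leq_ltn_trans (leq0n i) ik.
apply/rowP => p; rewrite -(permKV pi p); set l := (_ p).
have Ek := idx_val m k km.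
rewrite [LHS]mxE perm_act_comp ?tpermK // [X in _ + X]mxE perm_vkE mxE.
rewrite [RHS]mxE evecE.
case: tpermP => [->|->|].
- by rewrite Ek eqxx ik ltnn prednK ?mulr1.
- rewrite Ek ltn_predL; case: eqP => [iE|].
    have : (i == k.-1 :> nat) by rewrite iE Ek.
    by move/eqP->; rewrite ltnn prednK ?ltn_predL ?k0 ?mulr1.
  move=> /eqP; rewrite -val_eqE /= Ek => iE.
  rewrite !ifT ?subrr ?mulr0 //; lia.
move=> /eqP li /eqP; rewrite -val_eqE /= Ek => lk.
rewrite [i == _]eq_sym (negPf li) mulr0.
rewrite (_ : (l < k.-1)%N = (l < k)%N) ?subrr //.
lia.
Qed.

(** For the 0-based [i], [idx i] is its predecessor, so the transposition is [(j-1, j)] with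
    [j = i + 1]. Both positions lie beyond the leading ones, where consecutive entries differ by
    [b i]. *)
Lemma swap_adjacent pi k i : (k < i)%N ->
  perm_act (perm_comp pi (tperm (idx i) i)) (vk b k) - perm_act pi (vk b k)
  = (b i)%:R *: (evec (pi (idx i)) - evec (pi i)) :> 'rV[R]_m.+1.
Proof.
move=> ki; apply/rowP => p; rewrite -(permKV pi p); set l := (_ p).
have Ei := idx_val m i (ltnW (ltn_ord i)).
have Si : (psum b i.+1)%:R = (psum b (idx i : 'I_m.+1).+1)%:R + (b i)%:R :> R.
  by rewrite -natrD psumS Ei prednK //; lia.
rewrite [LHS]mxE perm_act_comp ?tpermK // [X in _ + X]mxE perm_vkE mxE.
rewrite [RHS]mxE [X in _ * X]mxE [X in _ * (_ + X)]mxE !evecE.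
have ni : (idx i == i) = false by rewrite -val_eqE /= Ei; lia.
case: tpermP => [->|->|].
- by rewrite eqxx [i == _]eq_sym ni !ifF ?Si;
    [rewrite /=; lra|rewrite ?Ei; lia..].
- by rewrite eqxx ni !ifF ?Si;
    [rewrite /=; lra|rewrite ?Ei; lia..].
move=> /eqP/negPf li /eqP/negPf lj;
rewrite [idx i == _]eq_sym [i == _]eq_sym li lj.
by rewrite !subrr mulr0.
Qed.

Lemma lower_one pi k : (k <= m)%N ->
  perm_act pi (vk b k.+1) - perm_act pi (vk b k)
  = - ((psum b k.+1)%:R - 1) *: evec (pi (idx k.+1)) :> 'rV[R]_m.+1.
Proof.
move=> km; apply/rowP => p; rewrite -(permKV pi p); set l := (_ p).
have Ek := idx_val m k.+1 km.
rewrite [LHS]mxE [X in _ + X]mxE !perm_vkE [RHS]mxE evecE.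
case: eqP => [<-|/eqP]; first by rewrite Ek ltnn ltnSn mulr1 opprB.
rewrite -val_eqE /= Ek => lk.
rewrite (_ : (l < k.+1)%N = (l < k)%N) ?mulr0 ?subrr //.
lia.
Qed.

(** Applied with [pi] and [k] those of the neighbour: its tail inequality at [j] is tight there and
    its left side increases along the step from [w], so it fails for [t > 1]. *)
Lemma tail_step_le1 pi k w j (t : R) : (k <= j)%N ->
  P (w + t *: (perm_act pi (vk b k) - w)) ->
  0 < tail pi j (perm_act pi (vk b k) - w) -> t <= 1.
Proof.
move=> kj /(pf_polytope_tail _ pi j).
rewrite -/(tail _ _ _) -(tail_vk pi k j kj).
rewrite tailD tailZ tailB; nra.
Qed.

Lemma raise_one_max pi k i (t : R) : (i < k <= m.+1)%N -> (1 < psum b k)%N ->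
  P (perm_act pi (vk b k) + t *: (((psum b k)%:R - 1) *: evec (pi i))) ->
  t <= 1.
Proof.
move=> ik Sk; have /andP[ik' km] := ik; have Ek := idx_val m k km.
(* The direction is rewritten through the neighbour's permutation, in which the raised entry sits at
   position [k], so that its tail sum can be read off. *)
have piE : pi i = perm_comp pi (tperm i (idx k)) (idx k)
  by rewrite permM tpermR.
rewrite -(raise_one _ _ _ ik) => /(tail_step_le1 _ _ _ _ _ (leqnn k.-1)); apply.
by rewrite raise_one // piE tailZ tail_evec Ek leqnn mulr1 subr_gt0 ltr1n.
Qed.

Lemma swap_adjacent_max pi k i (t : R) : (k < i)%N ->
  P (perm_act pi (vk b k) +
     t *: ((b i)%:R *: (evec (pi (idx i)) - evec (pi i)))) ->
  t <= 1.
Proof.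
move=> ki; have Ei := idx_val m i (ltnW (ltn_ord i)).
have piE : pi i = perm_comp pi (tperm (idx i) i) (idx i)
  by rewrite permM tpermL.
have pjE : pi (idx i) = perm_comp pi (tperm (idx i) i) i
  by rewrite permM tpermR.
rewrite -(swap_adjacent _ _ _ ki).
move=> /(tail_step_le1 _ _ _ i _ (ltnW ki)); apply.
rewrite swap_adjacent // piE pjE tailZ tailB !tail_evec Ei leqnn.
by rewrite leqNgt ltn_predL (leq_ltn_trans _ ki) // subr0 mulr1 ltr0n hb.
Qed.

(** At [t = 1] the lowered entry has reached [1], the lower bound of every coordinate. *)
Lemma lower_one_max pi k (t : R) : (k <= m)%N -> (1 < psum b k.+1)%N ->
  P (perm_act pi (vk b k) +
     t *: (- ((psum b k.+1)%:R - 1) *: evec (pi (idx k.+1)))) ->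
  t <= 1.
Proof.
move=> km Sk /(pf_polytope_ge1 _ (pi (idx k.+1))).
have Ek : idx k.+1 = k :> nat := idx_val m k.+1 km.
rewrite mxE perm_vkE !mxE eqxx eqxx mulr1 Ek ltnn /=.
have : 1 < (psum b k.+1)%:R :> R by rewrite ltr1n.
by nra.
Qed.

Lemma raise_one_ge0 pi k i x : (i < k)%N -> P x ->
  0 <= (x - perm_act pi (vk b k)) 0 (pi i).
Proof.
move=> ik Px; rewrite mxE [X in _ + X]mxE perm_vkE ik subr_ge0.
exact: (pf_polytope_ge1 _ _ Px).
Qed.

Lemma tail_sub_le0 pi k j x : (k <= j)%N -> P x ->
  tail pi j (x - perm_act pi (vk b k)) <= 0.
Proof.
by move=> kj Px; rewrite tailB tail_vk // subr_le0; apply: pf_polytope_tail.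
Qed.

End Neighbours.

(** * The simple cone at a vertex, in the general and in the degenerate case *)

Section Edges.
Context {R : realType} {m : nat} {b : 'I_m.+1 -> nat}.
Implicit Types (pi s : 'S_m.+1) (v w x y : 'rV[R]_m.+1) (i j : 'I_m.+1).
Hypothesis hb : forall i, (0 < b i)%N.
Local Notation P := (pf_polytope b : classical_sets.set 'rV[R]_m.+1).

Lemma psum1 : psum b 1 = b (idx 1).
Proof.
by rewrite (idxS _ ord0 : idx 1 = ord0) (psumS b ord0) /psum big_pred0.
Qed.

(** This makes the coefficients [S_k - 1] and [S_(k+1) - 1] of the raising and lowering vectors
    positive. *)
Lemma psum_gt1 k : (2 <= b (idx 1))%N \/ (2 <= k)%N -> (0 < k <= m.+1)%N ->
  (1 < psum b k)%N.
Proof.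
move=> [b2|k2] /andP[k0 km].
  by rewrite (leq_trans _ (leq_psum _ _ _ k0)) ?psum1.
apply: leq_trans (leq_psum _ _ _ k2).
have m1 : (1 < m.+1)%N := leq_trans k2 km.
rewrite (psumS b (Ordinal m1)) /= psum1.
by have := hb (idx 1); have := hb (Ordinal m1); lia.
Qed.

Lemma vk01 : b (idx 1) = 1%N -> vk b 0 = vk b 1 :> 'rV[R]_m.+1.
Proof.
move=> b1; apply/rowP => i; rewrite !mxE /=; case: ltnP => //.
by rewrite ltnS leqn0 => /eqP i0; rewrite i0 psum1 b1.
Qed.

(** One ordinal [i] indexes all [n] directions: raising for [i < k], lowering for [i = k], swapping
    for [i > k]. At [k = n] no [i] equals [k], in accordance with the condition [k <= m]. *)
Lemma share_edge_simple_vk pi k w : (k <= m.+1)%N ->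
  ((0 < k)%N -> (1 < psum b k)%N) -> ((k <= m)%N -> (1 < psum b k.+1)%N) ->
  share_edge P (perm_act pi (vk b k)) w <->
  [\/ exists i, (i < k)%N
        /\ w = perm_act (perm_comp pi (tperm i (idx k))) (vk b k.-1),
      exists i, (k < i)%N
        /\ w = perm_act (perm_comp pi (tperm (idx i) i)) (vk b k)
    | (k <= m)%N /\ w = perm_act pi (vk b k.+1)].
Proof.
move=> km Sk Sk1; set v := perm_act pi _.
pose d i : 'rV[R]_m.+1 :=
  if (i < k)%N then ((psum b k)%:R - 1) *: evec (pi i)
  else if (i == k :> nat) then - ((psum b k.+1)%:R - 1) *: evec (pi (idx k.+1))
  else (b i)%:R *: (evec (pi (idx i)) - evec (pi i)).
pose u i :=
  if (i < k)%N then perm_act (perm_comp pi (tperm i (idx k))) (vk b k.-1)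
  else if (i == k :> nat) then perm_act pi (vk b k.+1)
  else perm_act (perm_comp pi (tperm (idx i) i)) (vk b k) : 'rV[R]_m.+1.
(* Each functional comes from an inequality tight at [v], with its sign chosen to be nonnegative on
   [P - v] and scaled to take the value [1] on [d i]. *)
pose f i x : R :=
  if (i < k)%N then ((psum b k)%:R - 1)^-1 * x 0 (pi i)
  else if (i == k :> nat) then - ((psum b k.+1)%:R - 1)^-1 * tail pi i x
  else - (b i)%:R^-1 * tail pi i x.
have Sk_gt0 i : (i < k)%N -> 0 < (psum b k)%:R - 1 :> R.
  by move=> ik; rewrite subr_gt0 ltr1n Sk // (leq_ltn_trans _ ik).
have Sk1_gt0 i : i = k :> nat -> 0 < (psum b k.+1)%:R - 1 :> R.
  by move=> ik; rewrite subr_gt0 ltr1n Sk1 // -ik -ltnS.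
have b_gt0 i : 0 < (b i)%:R :> R by rewrite ltr0n.
have kE i : i = k :> nat -> idx k.+1 = i by move<-; exact: idxS.
have vd i : v + d i = u i.
  rewrite /d /u; case: ltnP => ik; last case: eqP => [ik'|/eqP ik'].
  - by rewrite -(raise_one pi k i) ?ik // addrC subrK.
  - have km' : (k <= m)%N by rewrite -ik' -ltnS.
    by rewrite -(lower_one pi k km') addrC subrK.
  - have ki : (k < i)%N by lia.
    by rewrite -(swap_adjacent pi k i ki) addrC subrK.
apply: (iff_trans (B := exists i, w = v + d i)); last first.
  split; last first.
    move=> [[i [ik ->]]|[i [ki ->]]|[km' ->]].
    + by exists i; rewrite vd /u ik.
    + by exists i; rewrite vd /u !ifF //; lia.
    + have Ek : idx k.+1 = k :> nat := idx_val m k.+1 km'.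
      by exists (idx k.+1); rewrite vd /u Ek ltnn eqxx.
  move=> [i ->]; rewrite vd /u; case: ltnP => ik;
    last case: eqP => [ik'|/eqP ik'].
  + by apply: Or31; exists i.
  + by apply: Or33; split => //; rewrite -ik' -ltnS.
  + by apply: Or32; exists i; split => //; lia.
apply: (share_edge_dual_basis _ _ _ d f).
- exact: convex_conv_hull.
- exact: pf_polytope_vk.
- move=> i t x y; rewrite /f; case: ifP => _; last case: ifP => _.
  + by rewrite !mxE; lra.
  + by rewrite tail_scalar; lra.
  + by rewrite tail_scalar; lra.
(* A swap moves [b i] from position [i] to the one before it, so it changes only the tail sum from
   [i] on. Raising affects only positions before [k], and lowering, at position [k], affects only
   the tail from [k] on among the tails used. *)
- move=> i j; rewrite /d /f.
  have Ei := idx_val m i (ltnW (ltn_ord i)).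
  have coordZ t x p : (t *: x) 0 p = t * x 0 p by rewrite mxE.
  have coordB x y p : (x - y) 0 p = x 0 p - y 0 p by rewrite !mxE.
  have mulrb0 (r : R) : r * false%:R = 0 by rewrite mulr0.
  case: (ltnP i k) => ik; last case: eqP => [ik'|/eqP ik'];
   (case: (ltnP j k) => jk; last case: eqP => [jk'|/eqP jk']);
   rewrite ?(kE i) //
     ?(coordZ, coordB, tailZ, tailB, evecE, tail_evec) -?val_eqE /= ?Ei.
  + by rewrite mulKf // gt_eqF // (Sk_gt0 i).
  + have [-> ->] : (j <= i)%N = false /\ (i == j :> nat) = false by lia.
    by rewrite !mulrb0.
  + have [-> ->] : (j <= i)%N = false /\ (i == j :> nat) = false by lia.
    by rewrite !mulrb0.
  + have -> : (i == j :> nat) = false by lia.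
    by rewrite !mulrb0.
  + rewrite ik' jk' leqnn eqxx mulr1 mulrNN.
    by rewrite mulVf // gt_eqF // (Sk1_gt0 i).
  + have [-> ->] : (j <= i)%N = false /\ (i == j :> nat) = false by lia.
    by rewrite !mulrb0.
  + have [-> ->] : (i.-1 == j :> nat) = false /\ (i == j :> nat) = false by lia.
    by rewrite subrr !mulr0.
  + have [-> ->] : (j <= i.-1)%N = (j <= i)%N /\ (i == j :> nat) = false by lia.
    by rewrite subrr !mulr0.
  + case: eqP => [/val_inj ij|/eqP ij].
      have -> : (j <= i.-1)%N = false by rewrite -ij; lia.
      by rewrite -ij leqnn sub0r mulrN mulr1 mulrNN mulVf // gt_eqF.
    have -> : (j <= i.-1)%N = (j <= i)%N by lia.
    by rewrite subrr !mulr0.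
- move=> i; rewrite vd /u; case: ifP => _; [|case: ifP => _];
    exact: pf_polytope_vk.
- move=> i x Px; rewrite /f; case: ltnP => ik; last case: eqP => ik'.
  + by rewrite mulr_ge0 ?invr_ge0 ?(ltW (Sk_gt0 i ik)) // raise_one_ge0.
  + rewrite mulNr -mulrN mulr_ge0 ?invr_ge0 ?(ltW (Sk1_gt0 i ik')) //.
    by rewrite oppr_ge0 tail_sub_le0.
  + rewrite mulNr -mulrN mulr_ge0 ?invr_ge0 ?(ltW (b_gt0 i)) //.
    by rewrite oppr_ge0 tail_sub_le0.
- move=> i t; rewrite /d; case: ltnP => ik; last case: eqP => [ik'|/eqP ik'].
  + by apply: raise_one_max; rewrite ?ik ?Sk // (leq_ltn_trans _ ik).
  + have km' : (k <= m)%N by rewrite -ik' -ltnS.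
    by apply: lower_one_max => //; exact: Sk1.
  + by apply: swap_adjacent_max => //; lia.
Qed.

(** Index [0] stands for lowering, [i > 0] for the swap of [i] with its predecessor. As [S_1 = 1],
    the tail inequality from the 0-based position [1] on follows from the one from [0] on and the
    lower bound at position [0]; hence the functional of index [1] is that coordinate instead of a
    tail sum. *)
Lemma share_edge_vk1 pi w : (0 < m)%N -> b (idx 1) = 1%N ->
  share_edge P (perm_act pi (vk b 1)) w <->
  (exists i, (0 < i)%N
     /\ w = perm_act (perm_comp pi (tperm (idx i) i)) (vk b 1))
  \/ w = perm_act pi (vk b 2).
Proof.
move=> m0 b1; set v := perm_act pi _.
pose d i : 'rV[R]_m.+1 :=
  if i == 0%N :> nat then - ((psum b 2)%:R - 1) *: evec (pi (idx 2))
  else (b i)%:R *: (evec (pi (idx i)) - evec (pi i)).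
pose u i : 'rV[R]_m.+1 :=
  if i == 0%N :> nat then perm_act pi (vk b 2)
  else perm_act (perm_comp pi (tperm (idx i) i)) (vk b 1).
pose f i x : R :=
  if i == 0%N :> nat then - ((psum b 2)%:R - 1)^-1 * tail pi i x
  else if i == 1%N :> nat then (b i)%:R^-1 * x 0 (pi (idx 1))
  else - (b i)%:R^-1 * tail pi i x.
have S2 : (1 < psum b 2)%N by apply: psum_gt1 => //; right.
have S2_gt0 : 0 < (psum b 2)%:R - 1 :> R by rewrite subr_gt0 ltr1n.
have b_gt0 i : 0 < (b i)%:R :> R by rewrite ltr0n.
have E1 : (idx 1 : 'I_m.+1) = 0%N :> nat := idx_val m 1 isT.
have E2 : (idx 2 : 'I_m.+1) = 1%N :> nat := idx_val m 2 m0.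
(* Reading [v] as [pi (v_0)] makes the tail inequality from [0] on tight and admits the swap at
   [i = 1]. *)
have vE : v = perm_act pi (vk b 0) by rewrite vk01.
have vd i : v + d i = u i.
  rewrite /d /u; case: (posnP i) => i0.
    by rewrite -[RHS](subrK v) addrC (lower_one pi 1 m0).
  by rewrite vE -(swap_adjacent pi 0 i i0) vk01 // addrC subrK.
apply: (iff_trans (B := exists i, w = v + d i)); last first.
  split; last first.
    move=> [[i [i0 ->]]|->].
    + by exists i; rewrite vd /u gtn_eqF.
    + by exists (idx 1); rewrite vd /u E1.
  move=> [i ->]; rewrite vd /u; case: (posnP i) => i0.
  + by right.
  + by left; exists i.
apply: (share_edge_dual_basis _ _ _ d f).
- exact: convex_conv_hull.
- exact: pf_polytope_vk.
- move=> i t x y; rewrite /f; case: ifP => _; last case: ifP => _.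
  + by rewrite tail_scalar; lra.
  + by rewrite !mxE; lra.
  + by rewrite tail_scalar; lra.
- move=> i j; rewrite /d /f.
  have Ei := idx_val m i (ltnW (ltn_ord i)).
  have coordZ t x p : (t *: x) 0 p = t * x 0 p by rewrite mxE.
  have coordB x y p : (x - y) 0 p = x 0 p - y 0 p by rewrite !mxE.
  have mulrb0 (r : R) : r * false%:R = 0 by rewrite mulr0.
  case: (eqVneq (i : nat) 0%N) => i0;
   (case: (eqVneq (j : nat) 0%N) => j0;
    last case: (eqVneq (j : nat) 1%N) => j1);
   rewrite ?(coordZ, coordB, tailZ, tailB, evecE, tail_evec) -?val_eqE /=
     ?E1 ?E2 ?Ei.
  + by rewrite i0 j0 !mulr1 mulrNN mulVf // gt_eqF.
  + by rewrite i0 j1 !mulrb0.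
  + have [-> ->] : (j <= 1)%N = false /\ (i == j :> nat) = false by lia.
    by rewrite !mulrb0.
  + have [-> ->] : (j <= i.-1)%N = (j <= i)%N /\ (i == j :> nat) = false by lia.
    by rewrite subrr !mulr0.
  + rewrite (negPf i0) subr0; case: (eqVneq (i : nat) j) => ij.
      by rewrite (val_inj ij) j1 mulr1 mulVf // gt_eqF.
    have -> : (i.-1 == 0)%N = false by lia.
    by rewrite !mulrb0.
  + case: eqP => [/val_inj ij|/eqP ij].
      have -> : (j <= i.-1)%N = false by rewrite -ij; lia.
      by rewrite -ij leqnn sub0r mulrN mulr1 mulrNN mulVf // gt_eqF.
    have -> : (j <= i.-1)%N = (j <= i)%N by lia.
    by rewrite subrr !mulr0.
- by move=> i; rewrite vd /u; case: ifP => _; exact: pf_polytope_vk.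
- move=> i x Px; rewrite /f; case: eqP => i0; last case: eqP => i1.
  + rewrite vE mulNr -mulrN mulr_ge0 ?invr_ge0 ?(ltW S2_gt0) //.
    by rewrite oppr_ge0 tail_sub_le0.
  + by rewrite mulr_ge0 ?invr_ge0 ?(ltW (b_gt0 i)) // raise_one_ge0 // E1.
  + rewrite vE mulNr -mulrN mulr_ge0 ?invr_ge0 ?(ltW (b_gt0 i)) //.
    by rewrite oppr_ge0 tail_sub_le0.
- move=> i t; rewrite /d; case: (posnP i) => i0.
  + exact: (lower_one_max pi 1).
  + by rewrite vE; exact: swap_adjacent_max.
Qed.

End Edges.

(* The n of the text is m.+1. *)
Theorem proposition2p6 (R : realType) (m : nat) (b : 'I_m.+1 -> nat)
    (v w : 'rV[R]_m.+1) (pi : 'S_m.+1) (k : nat)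
    (hb : forall i, (0 < b i)%N)
    (hnb : ~ (m.+1 = 1%N /\ b (idx 1) = 1%N))
    (hv : vertex (pf_polytope b) v)
    (hw : vertex (pf_polytope b) w)
    (hk : (k <= m.+1)%N)
    (hvk : v = perm_act pi (vk b k)) :
  ((2 <= b (idx 1))%N \/ (b (idx 1) = 1%N /\ (2 <= k)%N) ->
    (share_edge (pf_polytope b) v w <->
      [\/ exists j : nat, (1 <= j <= k)%N
            /\ w = perm_act (perm_comp pi (tperm (idx j) (idx k))) (vk b k.-1),
          exists j : nat, (k + 2 <= j <= m.+1)%N
            /\ w = perm_act (perm_comp pi (tperm (idx j.-1) (idx j))) (vk b k)
        | (k <= m)%N /\ w = perm_act pi (vk b k.+1)])
    /\ [/\ forall j : nat, (1 <= j <= k)%N ->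
            w = perm_act (perm_comp pi (tperm (idx j) (idx k))) (vk b k.-1) ->
            w - v = ((psum b k)%:R - 1) *: evec (pi (idx j)),
          forall j : nat, (k + 2 <= j <= m.+1)%N ->
            w = perm_act (perm_comp pi (tperm (idx j.-1) (idx j))) (vk b k) ->
            w - v = (b (idx j))%:R
                      *: (evec (pi (idx j.-1)) - evec (pi (idx j)))
        & (k <= m)%N -> w = perm_act pi (vk b k.+1) ->
            w - v = - ((psum b k.+1)%:R - 1) *: evec (pi (idx k.+1))])
  /\
  (b (idx 1) = 1%N /\ (k = 0%N \/ k = 1%N) ->
    [/\ vk b k = vk b 0 :> 'rV[R]_m.+1 /\ vk b 0 = vk b 1 :> 'rV[R]_m.+1,
        share_edge (pf_polytope b) v w <->
          (exists j : nat, (2 <= j <= m.+1)%N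
             /\ w = perm_act (perm_comp pi (tperm (idx j.-1) (idx j))) (vk b 1))
          \/ w = perm_act pi (vk b 2),
        forall j : nat, (2 <= j <= m.+1)%N ->
          w = perm_act (perm_comp pi (tperm (idx j.-1) (idx j))) (vk b 1) ->
          w - v = (b (idx j))%:R
                    *: (evec (pi (idx j.-1)) - evec (pi (idx j)))
      & w = perm_act pi (vk b 2) ->
          w - v = - (b (idx 2))%:R *: evec (pi (idx 2))]).
Proof.
pose I := 'I_m.+1.
have idx_lt j k' : (1 <= j <= k')%N -> (k' <= m.+1)%N -> ((idx j : I) < k')%N.
  by move=> /andP[j1 jk] km; rewrite idx_val ?prednK // (leq_trans jk).
have idx_gt j k' : (k' + 2 <= j <= m.+1)%N -> (k' < (idx j : I))%N.
  by move=> /andP[kj jm]; rewrite idx_val //; lia.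
(* [idx] reads the 0-based value of [idx j] as a 1-based index, so applying it twice shifts [j] to
   [j - 1]. *)
have idxK j : (j <= m.+1)%N -> idx (idx j : I) = idx j.-1 :> I.
  by move=> jm; rewrite idx_val.
subst v; split.
  move=> hbk; have hbk' : (2 <= b (idx 1))%N \/ (2 <= k)%N by case: hbk; tauto.
  have Sk : (0 < k)%N -> (1 < psum b k)%N.
    by move=> k0; apply: psum_gt1; rewrite ?k0.
  have Sk1 : (k <= m)%N -> (1 < psum b k.+1)%N.
    by move=> km; apply: psum_gt1 => //; case: hbk' => [|/ltnW]; [left|right].
  split.
    apply: (iff_trans (share_edge_simple_vk hb pi k w hk Sk Sk1)); split.
      move=> [[i [ik ->]]|[i [ki ->]]|?].
      + by apply: Or31; exists i.+1; rewrite idxS ltnS ik.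
      + by apply: Or32; exists i.+1; rewrite idxS addn2 !ltnS ki -ltnS ltn_ord.
      + exact: Or33.
    move=> [[j [jk ->]]|[j [kj ->]]|?].
    + by apply: Or31; exists (idx j); split => //; exact: idx_lt.
    + have /andP[_ jm] := kj.
      apply: Or32; exists (idx j); rewrite idxK //.
      by split => //; exact: idx_gt.
    + exact: Or33.
  split=> [j jk ->|j kj ->|km ->].
  - by rewrite raise_one // hk andbT idx_lt.
  - have /andP[_ jm] := kj.
    by rewrite -idxK // swap_adjacent // idx_gt.
  - exact: lower_one.
move=> [b1 k01].
(* Since [b_1 = 1], the excluded case [n = 1 = b_1] rules out [m = 0], so position [2] exists. *)
have m0 : (0 < m)%N.
  by case: (posnP m) => // m0; case: hnb; split=> //; congr _.+1.
have vkE : vk b k = vk b 1 :> 'rV[R]_m.+1 by case: k01 => -> //; exact: vk01.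
(* With [b_1 = 1] the lowering coefficient [S_2 - 1] becomes [b_2]. *)
have S2 : psum b 2 = (b (idx 2)).+1.
  have m1 : (1 < m.+1)%N by [].
  rewrite (psumS b (Ordinal m1)) /= psum1 b1 add1n; congr (b _).+1.
  by rewrite -[LHS]idxS.
rewrite vkE vk01 //; split => // [|j jm ->|->].
- apply: (iff_trans (share_edge_vk1 hb pi w m0 b1)); split.
    move=> [[i [i0 ->]]|->]; last by right.
    by left; exists i.+1; rewrite idxS ltnS i0 ltn_ord.
  move=> [[j [jm ->]]|->]; last by right.
  have /andP[_ jm'] := jm.
  by left; exists (idx j); rewrite idxK //; split => //; exact: idx_gt.
- have /andP[_ jm'] := jm.
  by rewrite -vk01 // -idxK // swap_adjacent // idx_gt.
- by rewrite lower_one // S2 -[(b _).+1]addn1 natrD addrK.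
Qed.
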